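(* Let $R$ be a ring. The following statements are equivalent. 1. The ring $R$ has a semisimple left quotient ring. 2. There are left denominator sets $S_1',\ldots,S_n'$ of the ring $R$ such that the rings $R_i:=S_i'^{-1}R$, $i=1,\ldots,n$, are simple left Artinian rings and the map $$\sigma:=\prod_{i=1}^n\sigma_i:R\to\prod_{i=1}^nR_i,\quad r\mapsto\Bigl(\frac r1,\ldots,\frac r1\Bigr),$$ is an injection, where $\sigma_i:R\to R_i$, $r\mapsto\frac r1$. If one of the equivalent conditions holds (and $S_1',\dots,S_n'$ are as in statement 2), then the set $\mathrm{max.Den}_l(R)$ contains precisely the distinct elements of the set $\{\sigma_i^{-1}(R_i^* )\mid i=1,\ldots,n\}$, where $R_i^*$ is the group of units of $R_i$.
   Context: Rings are associative with $1\neq0$. A multiplicative subset of a ring $R$ is a subset $S$ closed under multiplication with $1\in S$, $0\notin S$. It is a left Ore set if $Sr\cap Rs\neq\emptyset$ for all $r\in R$, $s\in S$. For such $S$ put $\mathrm{ass}(S):=\{r\in R\mid sr=0\text{ for some }s\in S\}$ (an ideal of $R$). A left Ore set $S$ is a left denominator set if $rs=0$ with $r\in R,s\in S$ implies $r\in\mathrm{ass}(S)$. Then $S^{-1}R=\{s^{-1}r\mid s\in S,r\in R\}$ is the left localization of $R$ at $S$. $\mathrm{max.Den}_l(R)$ is the set of left denominator sets of $R$ that are maximal with respect to inclusion. Let $\mathcal C$ be the set of regular elements (non-zero-divisors) of $R$. $R$ has a left quotient ring if $\mathcal C$ is a left Ore set, and then the left quotient ring is $\mathcal C^{-1}R$.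 Semisimple means semisimple Artinian. *)

(* Defs.v *)
From HB Require Import structures.
From mathcomp Require Import all_boot all_algebra.
From mathcomp Require Import boolp classical_sets.
Set Implicit Arguments.
Unset Strict Implicit.
Unset Printing Implicit Defensive.
Import GRing.Theory.
Local Open Scope classical_set_scope.
Local Open Scope ring_scope.

(* Rings are associative with 1 != 0 and not assumed commutative: nzRingType.
   Subsets of a ring are Prop-valued ([set R]).  As an arbitrary nzRingType
   carries no inverse operation, units are defined by hand. *)

Section RingNotions.
Variable A : nzRingType.
Implicit Types (I L : set A) (x y : A).

Definition inverses x y : Prop := x * y = 1 /\ y * x = 1.

Definition units : set A := [set x | exists y, inverses x y].

Definition left_ideal I : Prop :=
  [/\ I 0,
      forall x y, I x -> I y -> I (x + y) &
      forall a x, I x -> I (a * x)].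

Definition two_sided_ideal I : Prop :=
  left_ideal I /\ forall x a, I x -> I (x * a).

Definition left_artinian : Prop :=
  forall I : nat -> set A,
    (forall k, left_ideal (I k)) ->
    (forall k, I k.+1 `<=` I k) ->
    exists N, forall k, (N <= k)%N -> I k = I N.

Definition simple_ring : Prop :=
  forall I, two_sided_ideal I -> I = [set 0] \/ I = setT.

Definition simple_left_artinian : Prop := simple_ring /\ left_artinian.

Definition minimal_left_ideal L : Prop :=
  [/\ left_ideal L, L <> [set 0] &
      forall I, left_ideal I -> I `<=` L -> I = [set 0] \/ I = L].

(* The left regular module is the sum of its simple submodules. *)
Definition semisimple_regular_module : Prop :=
  forall x, exists (m : nat) (L : 'I_m -> set A) (u : 'I_m -> A),
    (forall j, minimal_left_ideal (L j) /\ L j (u j)) /\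
    x = \sum_(j < m) u j.

Definition semisimple_artinian : Prop :=
  semisimple_regular_module /\ left_artinian.

End RingNotions.

Section Localization.
Variable R : nzRingType.
Implicit Types (S T : set R).

Definition multiplicative S : Prop :=
  [/\ forall s t, S s -> S t -> S (s * t), S 1 & ~ S 0].

Definition left_ore S : Prop :=
  multiplicative S /\
  forall r s, S s -> exists s' r', S s' /\ s' * r = r' * s.

Definition ass S : set R := [set r | exists s, S s /\ s * r = 0].

Definition left_denominator S : Prop :=
  left_ore S /\ forall r s, S s -> r * s = 0 -> ass S r.

(* [f : R -> Q] is the left localization r |-> r/1 of R at S, that is
   Q = S^{-1} R = { s^{-1} r | s in S, r in R }, where r/1 = 0 exactly
   when r is in ass(S).  It exists for every left denominator set S (Ore),
   and it is unique up to a unique isomorphism under R. *)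
Definition is_left_localization S (Q : nzRingType) (f : {rmorphism R -> Q}) :
    Prop :=
  [/\ forall s, S s -> units (f s),
      forall q, exists s r t, [/\ S s, inverses (f s) t & q = t * f r] &
      forall r, f r = 0 <-> ass S r].

Definition max_Den_l : set (set R) :=
  [set S | left_denominator S /\
           forall T, left_denominator T -> S `<=` T -> T = S].

Definition regular_elements : set R :=
  [set c | GRing.lreg c /\ GRing.rreg c].

Definition has_semisimple_left_quotient_ring : Prop :=
  left_ore regular_elements /\
  exists (Q : nzRingType) (f : {rmorphism R -> Q}),
    is_left_localization regular_elements f /\ semisimple_artinian Q.

(* The product of the rings Q i is the type [forall i, Q i]. *)
Definition simple_artinian_embedding (n : nat) (S : 'I_n -> set R)
    (Q : 'I_n -> nzRingType) (sigma : forall i, {rmorphism R -> Q i}) : Prop :=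
  (forall i, [/\ left_denominator (S i),
                 is_left_localization (S i) (sigma i) &
                 simple_left_artinian (Q i)]) /\
  injective (fun (r : R) (i : 'I_n) => sigma i r).

End Localization.

Arguments left_artinian A : clear implicits.
Arguments simple_ring A : clear implicits.
Arguments simple_left_artinian A : clear implicits.
Arguments semisimple_regular_module A : clear implicits.
Arguments semisimple_artinian A : clear implicits.
Arguments units A : clear implicits.
Arguments regular_elements R : clear implicits.
Arguments max_Den_l R : clear implicits.
Arguments has_semisimple_left_quotient_ring R : clear implicits.

(* Main.v *)
Require Import Defs.
From HB Require Import structures.
From mathcomp Require Import all_boot all_algebra.
From mathcomp Require Import boolp classical_sets.
Set Implicit Arguments.
Unset Strict Implicit.
Unset Printing Implicit Defensive.
Import GRing.Theory.
Local Open Scope classical_set_scope.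
Local Open Scope ring_scope.

(** Write [p i] for the kernel of [sigma i] and [T i] for the preimage of the
    units of [Q i]; the ring [Q i] is also the localization of [R] at [T i].

    Everything rests on one property of a localization [f : R -> Q] with [Q]
    simple left Artinian ([ideal_meets_units]): a two-sided ideal of [R] that
    is not contained in [ker f] contains an element mapped to a unit of [Q].
    Moreover [f c] is a unit as soon as [f (r c) = 0] implies [f r = 0]
    ([localization_unitP]).

    Maximal denominator sets. Let [T] be a left denominator set. If
    [ass T <= p i], then [T <= T i]: from [r t] in [p i] one gets
    [s r t = 0], so [s r] is in [ass T <= p i]. For [T] containing [T i], the
    inclusion [ass T <= p i] holds, since otherwise the ideal [ass T] would
    meet [T i <= T], which is impossible in a denominator set. So every [T i]
    is maximal. For an arbitrary [T], some [p i] contains [ass T]: otherwise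
    [ass T] meets every [T i], and an element of [T] killing one element of
    each intersection lies in all the [p i], hence is zero. So every [T] is
    contained in some [T i].

    From the embedding to the quotient ring. In a subfamily minimal for the
    property that the [p i] have zero intersection, the intersection of the
    other [p j] is not contained in [p i], so it contains some [a i] mapped to
    a unit of [Q i]. The regular elements are those mapped to a unit in each
    factor, and sums [\sum_i a i * s i] provide common denominators for the
    elements of the product of the [Q i], which is therefore the left
    quotient ring; it is semisimple because its factors are
    ([separated_family_quotient_ring]).

    From the quotient ring to the embedding. In a semisimple ring [Q] write
    [1] as a finite sum of elements [u k] of minimal left ideals. The sum [e]
    of those [u k] whose ideal acts nontrivially on a given minimal left ideal
    [L] is a central idempotent cutting out the simple block of [L]
    ([minimal_left_ideal_block]). The corner rings [e Q] are simple left
    Artinian, they are localizations of [R], and together they separate the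
    elements of [Q]. *)

(** * Units and left ideals *)

Section UnitsAndIdeals.
Variable A : nzRingType.
Implicit Types (I L : set A) (u x y : A).

Lemma units1 : units A 1.
Proof. by exists 1; split; rewrite mul1r. Qed.

Lemma unitsM x y : units A x -> units A y -> units A (x * y).
Proof.
move=> [x' [xx' x'x]] [y' [yy' y'y]]; exists (y' * x'); split.
- by rewrite mulrA -(mulrA x) yy' mulr1.
- by rewrite mulrA -(mulrA y') x'x mulr1.
Qed.

Lemma unit_mull0 u x : units A u -> u * x = 0 -> x = 0.
Proof. by move=> [v [_ vu]] ux0; rewrite -(mul1r x) -vu -mulrA ux0 mulr0. Qed.

Lemma unit_mulr0 u x : units A u -> x * u = 0 -> x = 0.
Proof. by move=> [v [uv _]] xu0; rewrite -(mulr1 x) -uv mulrA xu0 mul0r. Qed.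

Lemma unit_neq0 u : units A u -> u <> 0.
Proof.
move=> uA u0; have /eqP := oner_neq0 A; apply.
by apply: (unit_mull0 uA); rewrite mulr1.
Qed.

Lemma left_ideal_sum I (J : Type) (r : seq J) (P : pred J) (F : J -> A) :
  left_ideal I -> (forall j, P j -> I (F j)) -> I (\sum_(j <- r | P j) F j).
Proof. by move=> [I0 ID _] IF; apply: big_ind. Qed.

(** The chain of left ideals [A c ^+ k] becomes stationary; cancelling
    powers of [c] on the right in [A c ^+ N = A c ^+ N.+1] makes [c] left
    invertible, and then [c] is invertible because [(c x - 1) c = 0]. *)
Lemma left_artinian_unit c :
  left_artinian A -> (forall x, x * c = 0 -> x = 0) -> units A c.
Proof.
move=> artA rc.
have rcX k x : x * c ^+ k = 0 -> x = 0.
  by elim: k x => [x|k IH x]; rewrite ?mulr1 // exprSr mulrA => /rc /IH.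
have [k||N Nst] := artA (fun k => [set x | exists y, x = y * c ^+ k]).
- split; first by exists 0; rewrite mul0r.
  + by move=> _ _ [y ->] [z ->]; exists (y + z); rewrite mulrDl.
  + by move=> a _ [y ->]; exists (a * y); rewrite mulrA.
- by move=> k _ [y ->]; exists (y * c); rewrite exprS mulrA.
have [x cx] : [set x | exists y, x = y * c ^+ N.+1] (c ^+ N).
  by rewrite Nst //; exists 1; rewrite mul1r.
have xc1 : x * c = 1.
  apply/eqP; rewrite -subr_eq0; apply/eqP/(rcX N).
  by rewrite mulrBl -mulrA -exprS -cx mul1r subrr.
exists x; split => //; apply/eqP; rewrite -subr_eq0; apply/eqP/rc.
by rewrite mulrBl -mulrA xc1 mulr1 mul1r subrr.
Qed.

Lemma minimal_left_ideal_eq I L x : minimal_left_ideal L ->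
  left_ideal I -> I `<=` L -> I x -> x <> 0 -> I = L.
Proof.
move=> [_ _ minL] lI IL Ix x0; have [I0|//] := minL I lI IL.
by case: x0; move: Ix; rewrite I0.
Qed.

Lemma minimal_left_ideal_neq0 L :
  minimal_left_ideal L -> exists2 x, L x & x <> 0.
Proof.
move=> [[L0 _ _] Lneq0 _]; apply: contrapT => noL; apply: Lneq0.
apply/seteqP; split => [x Lx|x ->//].
by apply: contrapT => x0; apply: noL; exists x.
Qed.

Definition mulr_image L x : set A := [set l * x | l in L].

Lemma mulr_image_left_ideal L x : left_ideal L -> left_ideal (mulr_image L x).
Proof.
move=> [L0 LD LM]; split; first by exists 0; rewrite ?mul0r.
- by move=> _ _ [l Ll <-] [m Lm <-]; exists (l + m); [exact: LD|rewrite mulrDl].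
- by move=> a _ [l Ll <-]; exists (a * l); [exact: LM|rewrite mulrA].
Qed.

End UnitsAndIdeals.

Lemma rmorph_units (A B : nzRingType) (f : {rmorphism A -> B}) x :
  units A x -> units B (f x).
Proof.
by move=> [y [xy yx]]; exists (f y); split; rewrite -rmorphM ?xy ?yx rmorph1.
Qed.

(** * Left localizations *)

Section Localization.
Variables (R Q : nzRingType) (f : {rmorphism R -> Q}).
Implicit Types (S T : set R) (r s : R).

Lemma localization_fraction S : is_left_localization S f ->
  forall q, exists s r, S s /\ f s * q = f r.
Proof.
move=> [_ frac _] q; have [s [r [t [Ss [st _] ->]]]] := frac q.
by exists s, r; rewrite mulrA st mul1r.
Qed.

(** A right fraction [f r * (f s)^-1] is also a left fraction, which is the
    Ore condition up to [ker f], and elements of [S] remove that kernel. *)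
Lemma left_denominator_of_fractions S :
  S 1 -> (forall s t, S s -> S t -> S (s * t)) ->
  (forall s, S s -> units Q (f s)) ->
  (forall q, exists s r, S s /\ f s * q = f r) ->
  (forall r, f r = 0 -> ass S r) ->
  left_denominator S /\ is_left_localization S f.
Proof.
move=> S1 SM Su frac ker; split; last first.
  split => // [q|r].
    have [s [r [Ss sq]]] := frac q; have [t [st ts]] := Su s Ss.
    by exists s, r, t; split=> //; rewrite -sq mulrA ts mul1r.
  split => [/ker//|[s [Ss sr0]]]; apply: (unit_mull0 (Su _ Ss)).
  by rewrite -rmorphM sr0 rmorph0.
split; last first.
  move=> r s Ss rs0; apply/ker/(unit_mulr0 (Su _ Ss)).
  by rewrite -rmorphM rs0 rmorph0.
split; first by split=> // /Su/unit_neq0; rewrite rmorph0.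
move=> r s Ss; have [t [st ts]] := Su s Ss.
have [c [b [Sc cb]]] := frac (f r * t).
have [|d [Sd]] := ker (c * r - b * s).
  by rewrite rmorphB !rmorphM -cb mulrA -(mulrA _ t) ts mulr1 subrr.
rewrite mulrBr !mulrA => /eqP; rewrite subr_eq0 => /eqP dcr.
by exists (d * c), (d * b); split; [exact: SM|].
Qed.

(** The set [S] enters a localization only through [ker f] and the fractions
    it provides, so it may be enlarged to everything that [f] inverts. *)
Lemma localization_saturation S : is_left_localization S f ->
  left_denominator (f @^-1` units Q) /\
  is_left_localization (f @^-1` units Q) f.
Proof.
move=> loc; have [Su _ ker] := loc.
apply: left_denominator_of_fractions => //.
- by rewrite /preimage /= rmorph1; exact: units1.
- by rewrite /preimage /= => s t us ut; rewrite rmorphM; exact: unitsM.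
- move=> q; have [s [r [Ss sq]]] := localization_fraction loc q.
  by exists s, r; split => //; exact: Su.
- by move=> r /ker [s [Ss sr]]; exists s; split => //; exact: Su.
Qed.

(** Let [J] be the left ideal of fractions with numerator in [I].  For [s] in
    [S] the chain [J (f s)^k] becomes stationary, so [J (f s)^-1 = J]; hence
    [J] is two-sided, and [J = Q] by simplicity.  The fraction [1 = s^-1 b]
    gives the wanted [b]. *)
Lemma ideal_meets_units S I a : is_left_localization S f ->
  simple_left_artinian Q -> two_sided_ideal I -> I a -> f a <> 0 ->
  exists2 b, I b & units Q (f b).
Proof.
move=> loc [simQ artQ] [[I0 ID IL] IR] Ia fa0; have [Su fracQ _] := loc.
have frac q : exists s r, units Q (f s) /\ f s * q = f r.
  have [s [r [Ss sq]]] := localization_fraction loc q.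
  by exists s, r; split=> //; exact: Su.
pose J : set Q := [set x | exists s b, [/\ units Q (f s), I b & f s * x = f b]].
have J_f b : I b -> J (f b).
  move=> Ib; have [s [r [us sr]]] := frac 1.
  by exists s, (s * b); split; rewrite ?rmorphM //; exact: IL.
have JM q x : J x -> J (q * x).
  move=> [s [b [[t [st ts]] Ib sx]]].
  have [s' [r' [us' sq]]] := frac (q * t).
  exists s', (r' * b); split => //; first exact: IL.
  by rewrite rmorphM -sq -sx -!mulrA (mulrA t) ts mul1r.
have lJ : left_ideal J.
  split => //; first by rewrite -(rmorph0 f); exact: J_f.
  move=> x y [s [b [[t [st ts]] Ib sx]]] [s' [b' [[t' [st' ts']] Ib' sy]]].
  have [c [r [uc cr]]] := frac t.
  have [c' [r' [uc' cr']]] := frac (f c * t').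
  exists (c' * c), (c' * r * b + r' * b'); split.
  - by rewrite rmorphM; exact: unitsM.
  - by apply: ID; apply: IL.
  - rewrite rmorphD !rmorphM -cr -cr' -sx -sy mulrDr !mulrA.
    by rewrite -(mulrA _ t) ts mulr1 -(mulrA _ t') ts' mulr1.
have J_mulf x r : J x -> J (x * f r).
  move=> [s [b [us Ib sx]]]; exists s, (b * r); split => //; first exact: IR.
  by rewrite rmorphM -sx mulrA.
have J_mulV x s t : units Q (f s) -> f s * t = 1 -> J x -> J (x * t).
  move=> us st Jx.
  have [k||N Nst] := artQ (fun k => [set y | exists2 z, J z & y = z * f s ^+ k]).
  - split; first by exists 0; [case: lJ|rewrite mul0r].
    + move=> _ _ [y Jy ->] [z Jz ->]; exists (y + z); last by rewrite mulrDl.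
      by case: lJ => _ JD _; exact: JD.
    + by move=> q _ [y Jy ->]; exists (q * y); [exact: JM|rewrite mulrA].
  - move=> k _ [y Jy ->]; exists (y * f s); first exact: J_mulf.
    by rewrite exprS mulrA.
  have [z Jz xz] : [set y | exists2 z, J z & y = z * f s ^+ N.+1] (x * f s ^+ N).
    by rewrite Nst //; exists x.
  suff -> : x * t = z by [].
  have usN : units Q (f s ^+ N).
    elim: (N) => [|k IH]; rewrite ?expr0 ?exprS; first exact: units1.
    exact: unitsM.
  have -> : x = z * f s.
    apply/eqP; rewrite -subr_eq0; apply/eqP/(unit_mulr0 usN).
    by rewrite mulrBl xz exprS mulrA subrr.
  by rewrite -mulrA st mulr1.
have tJ : two_sided_ideal J.
  split => // x q Jx; have [s [r [t [Ss st ->]]]] := fracQ q.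
  rewrite mulrA; apply/J_mulf/(J_mulV _ s) => //; first exact: Su.
  by case: st.
have [J0|JT] := simQ J tJ.
  by case: fa0; have := J_f a Ia; rewrite J0.
have [s [b [us Ib]]] : J 1 by rewrite JT.
by rewrite mulr1 => sb; exists b; rewrite -?sb.
Qed.

(** Writing [q = s^-1 r], the equality [q f c = 0] becomes [f (r c) = 0]: the
    condition on [c], which only involves [ker f], makes [f c]
    right-cancellable in the left Artinian ring [Q]. *)
Lemma localization_unitP S c : is_left_localization S f -> left_artinian Q ->
  (forall r, f (r * c) = 0 -> f r = 0) -> units Q (f c).
Proof.
move=> loc artQ rc; apply: left_artinian_unit => // q qc0.
have [s [r [Ss sq]]] := localization_fraction loc q.
have [Su _ _] := loc; apply: (unit_mull0 (Su s Ss)); rewrite sq; apply: rc.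
by rewrite rmorphM -sq -mulrA qc0 mulr0.
Qed.

End Localization.

(** * Maximal left denominator sets *)

Section AssIdeal.
Variable R : nzRingType.
Implicit Types (S T : set R).

Lemma ass_two_sided_ideal T : left_ore T -> two_sided_ideal (ass T).
Proof.
move=> [[TM T1 _] ore]; split; last first.
  by move=> x a [s [Ts sx]]; exists s; split; rewrite // mulrA sx mul0r.
split; first by exists 1; split; rewrite ?mulr0.
- move=> x y [s [Ts sx]] [t [Tt ty]]; have [t' [s' [Tt' ts]]] := ore t s Ts.
  exists (t' * t); split; first exact: TM.
  by rewrite mulrDr {1}ts -!mulrA sx ty !mulr0 addr0.
- move=> a x [s [Ts sx]]; have [s' [a' [Ts' sa]]] := ore a s Ts.
  by exists s'; split; rewrite // mulrA sa -mulrA sx mulr0.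
Qed.

Lemma ass_common_annihilator T (r : seq R) : left_ore T ->
  (forall x, x \in r -> ass T x) ->
  exists2 t, T t & forall x, x \in r -> t * x = 0.
Proof.
move=> [[TM T1 _] ore]; elim: r => [|y r IH] rT; first by exists 1.
have [s Ts sr] : exists2 t, T t & forall x, x \in r -> t * x = 0.
  by apply: IH => x xr; apply: rT; rewrite inE xr orbT.
have [t [Tt ty]] : ass T y by apply: rT; rewrite inE eqxx.
have [t' [s' [Tt' ts]]] := ore t s Ts.
exists (t' * t); first exact: TM.
move=> x; rewrite inE => /orP [/eqP ->|xr]; first by rewrite -mulrA ty mulr0.
by rewrite ts -mulrA sr // mulr0.
Qed.

(** If [r t] is in [ker f = ass S] then [s r t = 0] for some [s], whence
    [s r] is in [ass T] and so in [ker f], that is [f r = 0]. *)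
Lemma left_denominator_sub_units (Q : nzRingType) (f : {rmorphism R -> Q}) S T :
  is_left_localization S f -> left_artinian Q -> left_denominator T ->
  (forall r, ass T r -> f r = 0) -> T `<=` f @^-1` units Q.
Proof.
move=> loc artQ [_ denT] assT t Tt; apply: (localization_unitP loc) => // r.
have [Su _ ker] := loc => /ker [s [Ss srt]].
have /assT : ass T (s * r) by apply: (denT _ t) => //; rewrite -mulrA.
by rewrite rmorphM => /(unit_mull0 (Su s Ss)).
Qed.

(** For a left denominator set [T] above the preimage of the units,
    [ass T] lies in [ker f]: otherwise it would contain some [b] with [f b]
    a unit, and then [b] and some annihilator of [b] would both be in [T]. *)
Lemma units_preimage_max_Den (Q : nzRingType) (f : {rmorphism R -> Q}) S :
  is_left_localization S f -> simple_left_artinian Q ->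
  max_Den_l R (f @^-1` units Q).
Proof.
move=> loc simQ; split; first by have [] := localization_saturation loc.
move=> T denT sub; apply/seteqP; split => //.
have [oreT _] := denT; have [[TM T1 T0] _] := oreT.
apply: (left_denominator_sub_units loc) => //; first by case: simQ.
move=> r assr; apply: contrapT => fr0.
have [b [t [Tt tb0]] ub] :=
  ideal_meets_units loc simQ (ass_two_sided_ideal oreT) assr fr0.
by apply: T0; rewrite -tb0; apply: TM => //; exact: sub.
Qed.

End AssIdeal.

Section MaxDen.
Variables (R : nzRingType) (n : nat) (S : 'I_n -> set R) (Q : 'I_n -> nzRingType).
Variable sigma : forall i : 'I_n, {rmorphism R -> Q i}.

(** If no kernel contains [ass T], then [ass T] has for each [i] an element
    [b i] with [sigma i (b i)] a unit; a common annihilator [t] in [T] of the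
    [b i] is killed by every [sigma i], so that [t = 0]. *)
Lemma left_denominator_sub_some_units T :
  simple_artinian_embedding S sigma -> left_denominator T ->
  exists i, T `<=` sigma i @^-1` units (Q i).
Proof.
move=> [all_i inj] denT; have [oreT _] := denT.
have [i assTi] : exists i, forall r, ass T r -> sigma i r = 0.
  apply: contrapT => none.
  have /choice [b bP] : forall i, exists b, ass T b /\ units (Q i) (sigma i b).
    move=> i; have [_ loci simi] := all_i i.
    have [r assr fr0] : exists2 r, ass T r & sigma i r <> 0.
      apply: contrapT => nor; apply: none; exists i => r assr.
      by apply: contrapT => fr0; apply: nor; exists r.
    have [b Tb ub] :=
      ideal_meets_units loci simi (ass_two_sided_ideal oreT) assr fr0.
    by exists b.
  have [x /mapP [i _ ->]|t Tt tb] :=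
    @ass_common_annihilator _ T [seq b i | i <- enum 'I_n] oreT.
    by have [] := bP i.
  have t0 : t = 0.
    apply: inj; apply: functional_extensionality_dep => i.
    have [_ ub] := bP i; rewrite rmorph0; apply: (unit_mulr0 ub).
    by rewrite -rmorphM tb ?rmorph0 // map_f // mem_enum.
  by have [[_ _ T0] _] := oreT; apply: T0; rewrite -t0.
exists i; have [_ loci [_ arti]] := all_i i.
exact: (left_denominator_sub_units loci).
Qed.

Lemma max_Den_simple_artinian_embedding :
  simple_artinian_embedding S sigma ->
  max_Den_l R = [set sigma i @^-1` units (Q i) | i in [set: 'I_n]].
Proof.
move=> emb; have [all_i _] := emb.
have maxi i : max_Den_l R (sigma i @^-1` units (Q i)).
  by have [_ loci simi] := all_i i; exact: (units_preimage_max_Den loci).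
apply/seteqP; split => [T [denT maxT]|_ [i _ <-]//].
have [i Ti] := left_denominator_sub_some_units emb denT.
by exists i => //; apply: maxT => //; have [] := maxi i.
Qed.

End MaxDen.

(** * Sums of minimal left ideals *)

Section SumOfMinimal.
Variable A : nzRingType.
Implicit Types (I L : set A) (u x y a : A).

Definition in_minimal u : Prop := exists2 L, minimal_left_ideal L & L u.

Definition sum_of_minimal x : Prop :=
  exists2 s : seq A, (forall u, u \in s -> in_minimal u) & x = \sum_(u <- s) u.

Lemma semisimple_regular_moduleP :
  semisimple_regular_module A <-> forall x, sum_of_minimal x.
Proof.
split=> ssA x.
  have [m [L [u [Lu ->]]]] := ssA x.
  exists [seq u j | j <- enum 'I_m]; last by rewrite big_map big_enum.
  by move=> _ /mapP [j _ ->]; have [] := Lu j; exists (L j).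
have [s s_min ->] := ssA x.
have /choice [L LP] : forall j : 'I_(size s),
    exists L, minimal_left_ideal L /\ L (tnth (in_tuple s) j).
  move=> j; have [|L] := s_min (tnth (in_tuple s) j); [exact: mem_tnth|].
  by move=> minL Lu; exists L.
by exists (size s), L, (tnth (in_tuple s)); split=> //; exact: big_tnth.
Qed.

Lemma sum_of_minimal0 : sum_of_minimal 0.
Proof. by exists [::]; rewrite ?big_nil. Qed.

Lemma sum_of_minimal1 u : in_minimal u -> sum_of_minimal u.
Proof.
by exists [:: u]; rewrite ?big_seq1 // => v; rewrite inE => /eqP ->.
Qed.

Lemma sum_of_minimalD x y :
  sum_of_minimal x -> sum_of_minimal y -> sum_of_minimal (x + y).
Proof.
move=> [s sP ->] [t tP ->]; exists (s ++ t); last by rewrite big_cat.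
by move=> u; rewrite mem_cat => /orP [/sP|/tP].
Qed.

(** A morphism of left modules maps a simple module to zero or to a simple
    module. *)
Lemma in_minimal_mulr u a : in_minimal u -> in_minimal (u * a).
Proof.
move=> [L minL Lu]; have [lL Ln0 Lmin] := minL.
have [La0|/existsNP [l /not_implyP [Ll la0]]] :=
  pselect (forall l, L l -> l * a = 0).
  by exists L => //; rewrite La0 //; case: lL.
exists (mulr_image L a); last by exists u.
split; first exact: mulr_image_left_ideal.
  move=> La0; apply: la0; have : mulr_image L a (l * a) by exists l.
  by rewrite La0.
move=> I [I0 ID IM] IL.
have [||K0|KL] := Lmin [set m | L m /\ I (m * a)].
- case: lL => L0 LD LM; split; first by split; rewrite ?mul0r.
  + move=> x y [Lx Ix] [Ly Iy].
    by split; rewrite ?mulrDl; [exact: LD|exact: ID].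
  + move=> b x [Lx Ix].
    by split; rewrite -?mulrA; [exact: LM|exact: IM].
- by move=> m [].
- left; apply/seteqP; split => [x Ix|x ->//].
  have [m Lm ma] := IL x Ix.
  have : [set m | L m /\ I (m * a)] m by rewrite /= ma.
  by rewrite K0 /= -ma => ->; rewrite mul0r.
- right; apply/seteqP; split => // _ [m Lm <-].
  have : [set m | L m /\ I (m * a)] m by rewrite KL.
  by case.
Qed.

Lemma sum_of_minimal_two_sided : two_sided_ideal sum_of_minimal.
Proof.
split; last first.
  move=> x a [s sP ->]; rewrite big_distrl /= big_seq.
  apply: big_ind => [||u us]; first exact: sum_of_minimal0.
    exact: sum_of_minimalD.
  exact/sum_of_minimal1/in_minimal_mulr/sP.
split; [exact: sum_of_minimal0|exact: sum_of_minimalD|].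
move=> a x [s sP ->]; rewrite big_distrr /= big_seq.
apply: big_ind => [||u us]; first exact: sum_of_minimal0.
  exact: sum_of_minimalD.
have [L minL Lu] := sP u us; apply: sum_of_minimal1; exists L => //.
by have [[_ _ LM] _ _] := minL; exact: LM.
Qed.

(** If every nonzero left ideal contained a smaller nonzero one, iterating this
    choice from the whole ring would give a strictly descending chain. *)
Lemma left_artinian_minimal_left_ideal :
  left_artinian A -> exists L : set A, minimal_left_ideal L.
Proof.
move=> artA; apply: contrapT => nomin.
have /choice [F FP] : forall L : set A, exists I : set A,
    left_ideal L -> L <> [set 0] ->
    [/\ left_ideal I, I <> [set 0], I `<=` L & I <> L].
  move=> L; apply: contrapT => /forallNP noI; apply: nomin; exists L.
  have [lL [Ln0 _]] : left_ideal L /\ L <> [set 0] /\ True.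
    have /not_implyP [lL /not_implyP [Ln0 _]] := noI L.
    by split.
  split => // I lI IL; apply: contrapT => /not_orP [I0 IneqL].
  by apply: (noI I).
pose J k := iter k F [set: A].
have J_ok k : left_ideal (J k) /\ J k <> [set 0].
  elim: k => [|k [lJ Jn0]]; last by have [] := FP (J k) lJ Jn0.
  split => // T0; have : J 0%N 1 by [].
  by rewrite T0 => /eqP; rewrite oner_eq0.
have [k|k|N Nst] := artA J; first by have [] := J_ok k.
  by have [lJ Jn0] := J_ok k; have [] := FP (J k) lJ Jn0.
have [lJ Jn0] := J_ok N; have [_ _ _] := FP (J N) lJ Jn0; apply.
exact: (Nst N.+1).
Qed.

(** The socle is a two-sided ideal, and it is nonzero since minimal left
    ideals exist; so it is the whole simple ring. *)
Lemma simple_left_artinian_semisimple :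
  simple_left_artinian A -> forall x, sum_of_minimal x.
Proof.
move=> [simA artA] x; have [L minL] := left_artinian_minimal_left_ideal artA.
have [s0|->//] := simA _ sum_of_minimal_two_sided.
have [u Lu u0] := minimal_left_ideal_neq0 minL; case: u0.
suff: [set x | sum_of_minimal x] u by rewrite s0.
by apply: sum_of_minimal1; exists L.
Qed.

End SumOfMinimal.

(** * Finite direct products of rings *)

Section DirectProduct.
Variables (I : finType) (i0 : I) (Q : I -> nzRingType).

(** The argument [i0] witnesses that the index type is inhabited, so that
    [1 != 0] in the product. *)
Definition direct_product (_ : I) (P : I -> nzRingType) : Type := forall i, P i.
Local Notation P := (direct_product i0 Q).
Implicit Types x y z : P.

Lemma direct_product_ext x y : (forall i, x i = y i) -> x = y.
Proof. exact: functional_extensionality_dep. Qed.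

HB.instance Definition _ := gen_eqMixin P.
HB.instance Definition _ := gen_choiceMixin P.

Let zero : P := fun=> 0.
Let one : P := fun=> 1.
Let opp x : P := fun i => - x i.
Let add x y : P := fun i => x i + y i.
Let mul x y : P := fun i => x i * y i.

Let addA : associative add.
Proof. by move=> x y z; apply: direct_product_ext => i; exact: addrA. Qed.
Let addC : commutative add.
Proof. by move=> x y; apply: direct_product_ext => i; exact: addrC. Qed.
Let add0 : left_id zero add.
Proof. by move=> x; apply: direct_product_ext => i; exact: add0r. Qed.
Let addN : left_inverse zero opp add.
Proof. by move=> x; apply: direct_product_ext => i; exact: addNr. Qed.
HB.instance Definition _ := GRing.isZmodule.Build P addA addC add0 addN.

Let mulA : associative mul.
Proof. by move=> x y z; apply: direct_product_ext => i; exact: mulrA. Qed.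
Let mul_onel : left_id one mul.
Proof. by move=> x; apply: direct_product_ext => i; exact: mul1r. Qed.
Let mul_oner : right_id one mul.
Proof. by move=> x; apply: direct_product_ext => i; exact: mulr1. Qed.
Let mulDl : left_distributive mul add.
Proof. by move=> x y z; apply: direct_product_ext => i; exact: mulrDl. Qed.
Let mulDr : right_distributive mul add.
Proof. by move=> x y z; apply: direct_product_ext => i; exact: mulrDr. Qed.
Let one_neq0 : one != zero.
Proof.
apply/eqP => /(congr1 (fun x : P => x i0)) /eqP.
by rewrite /one /zero oner_eq0.
Qed.
HB.instance Definition _ :=
  GRing.Zmodule_isNzRing.Build P mulA mul_onel mul_oner mulDl mulDr one_neq0.

Lemma direct_productD x y i : (x + y) i = x i + y i. Proof. by []. Qed.
Lemma direct_productM x y i : (x * y) i = x i * y i. Proof. by []. Qed.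

Lemma direct_product_sum (J : Type) (r : seq J) (p : pred J) (F : J -> P) i :
  (\sum_(j <- r | p j) F j) i = \sum_(j <- r | p j) F j i.
Proof. by apply: (big_morph (fun x : P => x i)). Qed.

Lemma direct_product_units x : (forall i, units (Q i) (x i)) -> units P x.
Proof.
move=> ux; exists (fun i => projT1 (cid (ux i))).
by split; apply: direct_product_ext => i; have [] := projT2 (cid (ux i)).
Qed.

Definition coord_emb i (a : Q i) : P := @dfwith I Q (fun=> 0) i a.

Lemma coord_emb_in i (a : Q i) : coord_emb a i = a.
Proof. exact: dfwith_in. Qed.

Lemma coord_emb_out i j (a : Q i) : i != j -> coord_emb a j = 0.
Proof. exact: dfwith_out. Qed.

Lemma coord_embP i (a : Q i) x :
  x i = a -> (forall j, i != j -> x j = 0) -> x = coord_emb a.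
Proof.
move=> xi xj; apply: direct_product_ext => j.
have [<-|ij] := eqVneq i j; first by rewrite coord_emb_in.
by rewrite coord_emb_out // xj.
Qed.

Lemma mul_coord_emb i (a b : Q i) x :
  x i = a -> x * coord_emb b = coord_emb (a * b).
Proof.
move=> xi; apply: coord_embP; rewrite ?direct_productM ?coord_emb_in ?xi //.
by move=> j ij; rewrite direct_productM coord_emb_out // mulr0.
Qed.

Lemma coord_embD i (a b : Q i) : coord_emb (a + b) = coord_emb a + coord_emb b.
Proof.
apply/esym/coord_embP; rewrite ?direct_productD ?coord_emb_in //.
by move=> j ij; rewrite direct_productD !coord_emb_out // addr0.
Qed.

Lemma coord_emb0 i : coord_emb (0 : Q i) = 0.
Proof. exact/esym/coord_embP. Qed.

Lemma sum_coord_emb x : x = \sum_i coord_emb (x i).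
Proof.
apply: direct_product_ext => j; rewrite direct_product_sum (bigD1 j) //=.
rewrite coord_emb_in big1 ?addr0 // => i ij; exact: coord_emb_out.
Qed.

Lemma coord_emb_preimage_left_ideal i (J : set P) :
  left_ideal J -> left_ideal [set a : Q i | J (coord_emb a)].
Proof.
move=> [J0 JD JM]; split => /=; first by rewrite coord_emb0.
  by move=> a b Ja Jb; rewrite coord_embD; exact: JD.
move=> a b Jb; rewrite -(@mul_coord_emb i a b (coord_emb a)) ?coord_emb_in //.
exact: JM.
Qed.

(** Multiplying by the [i]-th coordinate idempotent isolates the [i]-th
    coordinate, so left ideals of the product are determined by their traces
    on the factors. *)
Lemma left_ideal_coord (J : set P) : left_ideal J ->
  J = [set x | forall i, J (coord_emb (x i))].
Proof.
move=> lJ; apply/seteqP; split => x; last first.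
  by move=> Jx; rewrite (sum_coord_emb x); exact: left_ideal_sum.
move=> Jx i; have [_ _ JM] := lJ.
have -> : coord_emb (x i) = coord_emb (1 : Q i) * x; last exact: JM.
apply/esym/coord_embP; rewrite ?direct_productM ?coord_emb_in ?mul1r //.
by move=> j ij; rewrite direct_productM coord_emb_out // mul0r.
Qed.

Lemma direct_product_left_artinian :
  (forall i, left_artinian (Q i)) -> left_artinian P.
Proof.
move=> artQ J lJ decJ.
have /choice [N Nst] : forall i, exists N, forall k, (N <= k)%N ->
    [set a : Q i | J k (coord_emb a)] = [set a : Q i | J N (coord_emb a)].
  move=> i; apply: artQ => k; first exact: coord_emb_preimage_left_ideal.
  by move=> a; exact: decJ.
exists (\max_i N i) => k Nk.
rewrite (left_ideal_coord (lJ k)) (left_ideal_coord (lJ (\max_i N i))).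
have st i k' : (\max_i N i <= k')%N ->
    [set a : Q i | J k' (coord_emb a)] = [set a : Q i | J (N i) (coord_emb a)].
  by move=> Nk'; apply: Nst; apply: leq_trans Nk'; exact: leq_bigmax.
apply/seteqP; split => x Jx i.
- have : [set a : Q i | J k (coord_emb a)] (x i) by exact: Jx.
  by rewrite st // -(st i (\max_i N i)).
- have : [set a : Q i | J (\max_i N i) (coord_emb a)] (x i) by exact: Jx.
  by rewrite st // -(st i k).
Qed.

Lemma coord_emb_in_minimal i (a : Q i) :
  in_minimal a -> in_minimal (coord_emb a).
Proof.
move=> [L [lL Ln0 Lmin] La].
exists [set coord_emb b | b in L]; last by exists a.
have [L0 LD LM] := lL; split.
- split; first by exists 0; rewrite ?coord_emb0.
  + by move=> _ _ [b Lb <-] [c Lc <-]; exists (b + c);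
      [exact: LD|rewrite coord_embD].
  + by move=> x _ [b Lb <-]; exists (x i * b);
      [exact: LM|rewrite (@mul_coord_emb i (x i))].
- move=> eL0; apply: Ln0; apply/seteqP; split => [b Lb|b ->//].
  have : [set coord_emb b | b in L] (coord_emb b) by exists b.
  by rewrite eL0 => /= /(congr1 (fun x : P => x i)); rewrite coord_emb_in.
move=> J lJ JL.
have [||K0|KL] := Lmin [set b : Q i | J (coord_emb b)].
- exact: coord_emb_preimage_left_ideal.
- move=> b /JL [c Lc /(congr1 (fun x : P => x i))].
  by rewrite !coord_emb_in => <-.
- left; apply/seteqP; split => [x Jx|x -> ]; last by case: lJ.
  have [b Lb bx] := JL x Jx.
  have : [set b : Q i | J (coord_emb b)] b by rewrite /= bx.
  by rewrite K0 /= -bx => ->; exact: coord_emb0.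
- right; apply/seteqP; split => // _ [b Lb <-].
  have : [set b : Q i | J (coord_emb b)] b by rewrite KL.
  by [].
Qed.

Lemma direct_product_semisimple_artinian :
  (forall i, simple_left_artinian (Q i)) -> semisimple_artinian P.
Proof.
move=> simQ; split; last first.
  by apply: direct_product_left_artinian => i; case: (simQ i).
apply/semisimple_regular_moduleP => x; rewrite (sum_coord_emb x).
apply: big_ind => [||i _]; [exact: sum_of_minimal0|exact: sum_of_minimalD|].
have [s sP ->] := simple_left_artinian_semisimple (simQ i) (x i).
rewrite (big_morph _ (@coord_embD i) (coord_emb0 i)) big_seq.
apply: big_ind => [||u us]; [exact: sum_of_minimal0|exact: sum_of_minimalD|].
exact/sum_of_minimal1/coord_emb_in_minimal/sP.
Qed.

End DirectProduct.

(** * From simple Artinian localizations to the quotient ring *)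

Section SeparatedFamily.
Variables (R : nzRingType) (I : finType) (i0 : I) (Q : I -> nzRingType).
Variables (S : I -> set R) (sigma : forall i, {rmorphism R -> Q i}).
Hypothesis loc : forall i, is_left_localization (S i) (sigma i).
Hypothesis simQ : forall i, simple_left_artinian (Q i).
Hypothesis sigma_inj : forall r, (forall i, sigma i r = 0) -> r = 0.

(** For [c] regular, [r c] in [ker (sigma i) = ass (S i)] gives [s r c = 0], so
    [s r = 0] and [r] is in the kernel as well. *)
Lemma regular_elements_units :
  regular_elements R = [set c | forall i, units (Q i) (sigma i c)].
Proof.
apply/seteqP; split => c => [[_ rc] i|uc].
  apply: (localization_unitP (loc i)) => [|r]; first by case: (simQ i).
  have [_ _ ker] := loc i; move/ker => [s [Ss src]]; apply/ker; exists s.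
  by split=> //; apply: rc; rewrite mul0r -mulrA.
split => x y => [cxy|xyc]; apply/eqP; rewrite -subr_eq0; apply/eqP/sigma_inj => i.
- apply: (unit_mull0 (uc i)); rewrite -rmorphM mulrBr cxy subrr rmorph0 //.
- apply: (unit_mulr0 (uc i)); rewrite -rmorphM mulrBl xyc subrr rmorph0 //.
Qed.

Definition diagonal (r : R) : direct_product i0 Q := fun i => sigma i r.

Let diagonalB : {morph diagonal : x y / x - y}.
Proof. by move=> x y; apply: direct_product_ext => i; exact: rmorphB. Qed.
Let diagonalM : monoid_morphism diagonal.
Proof.
split; first by apply: direct_product_ext => i; exact: rmorph1.
by move=> x y; apply: direct_product_ext => i; exact: rmorphM.
Qed.
HB.instance Definition _ :=
  GRing.isZmodMorphism.Build R (direct_product i0 Q) diagonal diagonalB.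
HB.instance Definition _ :=
  GRing.isMonoidMorphism.Build R (direct_product i0 Q) diagonal diagonalM.

Hypothesis separated : forall i, exists2 a,
  units (Q i) (sigma i a) & forall j, i != j -> sigma j a = 0.

(** Given [q] in the product, write [q i = (s i)^-1 (r i)] in each factor. As
    [a i] is a unit at [i] and zero elsewhere, [c = \sum_i a i * s i] is a unit
    in every factor, and [c q] is the image of [\sum_i a i * r i]. *)
Lemma separated_family_quotient_ring : has_semisimple_left_quotient_ring R.
Proof.
have frac (q : direct_product i0 Q) :
    exists c r, regular_elements R c /\ diagonal c * q = diagonal r.
  have /choice [a aP] : forall i, exists a,
      units (Q i) (sigma i a) /\ forall j, i != j -> sigma j a = 0.
    by move=> i; have [a] := separated i; exists a.
  have /choice [sr srP] : forall i, exists sr : R * R,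
      units (Q i) (sigma i sr.1) /\ sigma i sr.1 * q i = sigma i sr.2.
    move=> i; have [s [r [Ss sq]]] := localization_fraction (loc i) (q i).
    by have [Su _ _] := loc i; exists (s, r); split => //; exact: Su.
  have sum_at (F : I -> R) i :
      sigma i (\sum_j a j * F j) = sigma i (a i) * sigma i (F i).
    rewrite rmorph_sum (bigD1 i) //= rmorphM big1 ?addr0 // => j ji.
    by rewrite rmorphM (aP j).2 ?mul0r.
  exists (\sum_j a j * (sr j).1), (\sum_j a j * (sr j).2); split.
    rewrite regular_elements_units => i; rewrite sum_at.
    by apply: unitsM; [case: (aP i)|case: (srP i)].
  apply: direct_product_ext => i.
  rewrite direct_productM /diagonal !sum_at -mulrA.
  by have [_ ->] := srP i.
have [||c||denC locC] := @left_denominator_of_fractions R _ diagonal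
    (regular_elements R) _ _ _ frac.
- by split; [exact: lreg1|exact: rreg1].
- move=> s t [ls rs] [lt rt]; split; first exact: lregM.
  exact: rregM.
- by rewrite {1}regular_elements_units => uc; exact: direct_product_units.
- move=> r r0; exists 1; rewrite mul1r.
  split; first by split; [exact: lreg1|exact: rreg1].
  by apply: sigma_inj => i; exact: (congr1 (fun x : direct_product i0 Q => x i) r0).
split; first by case: denC.
exists (direct_product i0 Q), diagonal; split => //.
exact: direct_product_semisimple_artinian.
Qed.

End SeparatedFamily.

(** A minimal subfamily with zero kernel intersection is separated: the
    ideal of elements killed by all members but the [i]-th is not killed by
    the [i]-th, so it contains an element mapped to a unit there. *)
Lemma embedding_quotient_ring (R : nzRingType) (n : nat) (S : 'I_n -> set R)
    (Q : 'I_n -> nzRingType) (sigma : forall i : 'I_n, {rmorphism R -> Q i}) :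
  simple_artinian_embedding S sigma -> has_semisimple_left_quotient_ring R.
Proof.
move=> [all_i inj].
pose faithful (A : {set 'I_n}) :=
  `[< forall r, (forall i, i \in A -> sigma i r = 0) -> r = 0 >].
have faithfulT : faithful finset.setT.
  apply/asboolP => r r0; apply: inj; apply: functional_extensionality_dep => i.
  by rewrite rmorph0 r0 // finset.in_setT.
have [A minA _] := minset_exists faithfulT.
have /asboolP faithA := minsetp minA.
have faithD i : i \in A -> exists2 r,
    forall j, j \in A -> i != j -> sigma j r = 0 & sigma i r <> 0.
  move=> iA; apply: contrapT => noR.
  have /(minsetinf minA) AD : faithful (A :\ i)%SET.
    apply/asboolP => r r0; apply: faithA => j jA.
    have [<-|ij] := eqVneq i j; last by rewrite r0 // finset.in_setD1 eq_sym ij.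
    apply: contrapT => ri; apply: noR; exists r => // k kA ik.
    by rewrite r0 // finset.in_setD1 eq_sym ik.
  by have := finset.setD11 i A; rewrite AD ?subsetDl ?iA.
have [i0 i0A] : exists i, i \in A.
  apply: contrapT => A0; have /eqP := oner_neq0 R; apply.
  by apply: faithA => i iA; case: A0; exists i.
apply: (@separated_family_quotient_ring R {i | i \in A} (exist _ i0 i0A)
  (fun i => Q (val i)) (fun i => S (val i)) (fun i => sigma (val i))).
- by move=> i; have [] := all_i (val i).
- by move=> i; have [] := all_i (val i).
- by move=> r r0; apply: faithA => i iA; exact: (r0 (exist _ i iA)).
move=> [i iA] /=; have [r r_out ri] := faithD i iA.
have [_ loci simi] := all_i i.
pose N : set R := [set x | forall j, j \in A -> i != j -> sigma j x = 0].
have idN : two_sided_ideal N.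
  split; last by move=> x a Nx j jA ij; rewrite rmorphM Nx ?mul0r.
  split; first by move=> j _ _; rewrite rmorph0.
    by move=> x y Nx Ny j jA ij; rewrite rmorphD Nx ?Ny ?addr0.
  by move=> a x Nx j jA ij; rewrite rmorphM Nx ?mulr0.
have [a Na ua] := ideal_meets_units loci simi idN r_out ri.
by exists a => // -[j jA] ij; exact: Na.
Qed.

(** * Simple blocks of a semisimple ring *)

Section Blocks.
Variable Q : nzRingType.
Variables (m : nat) (Lk : 'I_m -> set Q) (u : 'I_m -> Q).
Hypothesis minLk : forall k, minimal_left_ideal (Lk k).
Hypothesis Lku : forall k, Lk k (u k).
Hypothesis one_sum : 1 = \sum_k u k.
Implicit Types (I J L : set Q) (a e l x y : Q).

(** If [a u_k != 0] for some [a] in [J], then [J u_k] is the whole minimal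
    left ideal, [u_k = b u_k] with [b] in [J], and [a u_k = a b u_k = 0]. *)
Lemma square_zero_left_ideal J : left_ideal J ->
  (forall a b, J a -> J b -> a * b = 0) -> forall a, J a -> a = 0.
Proof.
move=> lJ J2 a Ja; rewrite -(mulr1 a) one_sum mulr_sumr big1 // => k _.
apply: contrapT => auk.
have Jk : mulr_image J (u k) = Lk k.
  apply: (minimal_left_ideal_eq (x := a * u k) (minLk k)) => //.
  - exact: mulr_image_left_ideal.
  - by move=> _ [b _ <-]; have [[_ _ LM] _ _] := minLk k; exact: LM.
  - by exists a.
have [b Jb bu] : mulr_image J (u k) (u k) by rewrite Jk.
by apply: auk; rewrite -bu mulrA (J2 a b) ?mul0r.
Qed.

(** Since [Lk x] is a nonzero left ideal in [L], it equals [L], so [L Lk = 0]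
    would give [L L = L Lk x = 0]. Hence [L y != 0] for some [y] in [Lk], and
    then [L y] is the whole of [Lk]. *)
Lemma minimal_left_ideal_link k L l x : minimal_left_ideal L ->
  Lk k l -> L x -> l * x <> 0 -> exists2 y, Lk k y & Lk k = mulr_image L y.
Proof.
move=> minL Ll Lx lx0; have [lL _ _] := minL; have [_ _ LM] := lL.
have [lLk _ _] := minLk k; have [_ _ LkM] := lLk.
have LkxL : mulr_image (Lk k) x = L.
  apply: (minimal_left_ideal_eq (x := l * x) minL) => //.
  - exact: mulr_image_left_ideal.
  - by move=> _ [b _ <-]; exact: LM.
  - by exists l.
have [z [y [Lz Ly zy0]]] : exists z y, [/\ L z, Lk k y & z * y <> 0].
  apply: contrapT => LLk0; apply: lx0.
  apply: (square_zero_left_ideal lL) => [a b La|]; last exact: LM.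
  rewrite -LkxL => -[y Ly <-]; rewrite mulrA.
  suff -> : a * y = 0 by rewrite mul0r.
  by apply: contrapT => ay; apply: LLk0; exists a, y.
exists y => //; apply/esym.
apply: (minimal_left_ideal_eq (x := z * y) (minLk k)) => //.
- exact: mulr_image_left_ideal.
- by move=> _ [b _ <-]; exact: LkM.
- by exists z.
Qed.

(** [e] is the identity of the isotypic component of [L]: the sum of the
    [u_k] over the [k] with [Lk L != 0]. The other [u_k] annihilate [L], so
    [1 - e] does. Conversely the annihilator [M] of [L] satisfies [L M = 0]
    (each [L y] with [y] in [M] squares to zero), and [Lk] is [L y] for the
    [k] in the sum; hence [e M = M e = 0]. A two-sided ideal outside [M]
    meets [L] nontrivially, so it contains [L], all [L y] and [e]. *)
Lemma minimal_left_ideal_block L : minimal_left_ideal L -> exists e,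
  [/\ forall x, e * x = x * e, e * e = e, e <> 0,
      forall I a, two_sided_ideal I -> I a -> e * a <> 0 -> I e &
      forall x, e * x = 0 -> forall l, L l -> x * l = 0].
Proof.
move=> minL; have [lL _ _] := minL; have [_ _ LM] := lL.
pose ann x := forall l, L l -> x * l = 0.
pose K k := `[< exists l x, [/\ Lk k l, L x & l * x <> 0] >].
pose e := \sum_(k | K k) u k.
have annC : ann (1 - e).
  move=> l Ll; rewrite one_sum (bigID K) /= -/e addrAC subrr add0r.
  rewrite mulr_suml big1 // => k /asboolPn notK.
  by apply: contrapT => ul; apply: notK; exists (u k), l.
have annM x y : ann y -> ann (x * y).
  by move=> y0 l Ll; rewrite -mulrA y0 ?mulr0.
have annMr x y : ann x -> ann (x * y).
  by move=> x0 l Ll; rewrite -mulrA x0 //; exact: LM.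
have L_ann l x : L l -> ann x -> l * x = 0.
  move=> Ll annx; apply: (square_zero_left_ideal (mulr_image_left_ideal x lL)).
    move=> _ _ [a La <-] [b Lb <-].
    by rewrite -mulrA (mulrA x) annx // mul0r mulr0.
  by exists l.
have uK k : K k -> exists l y, L l /\ u k = l * y.
  move=> /asboolP [l [x [Ll Lx lx]]].
  have [y Ly Lky] := minimal_left_ideal_link minL Ll Lx lx.
  by have := Lku k; rewrite Lky => -[l' Ll' <-]; exists l', y.
have e_ann x : ann x -> e * x = 0.
  move=> annx; rewrite mulr_suml big1 // => k /uK [l [y [Ll ->]]].
  by rewrite -mulrA; apply: L_ann => //; exact: annM.
have ann_e x : ann x -> x * e = 0.
  move=> annx; rewrite mulr_sumr big1 // => k /uK [l [y [Ll ->]]].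
  by rewrite mulrA annx // mul0r.
have exe x : e * x = e * x * e.
  have /e_ann : ann (x * (1 - e)) by exact: annM.
  by rewrite mulrBr mulr1 mulrBr mulrA => /eqP; rewrite subr_eq0 => /eqP.
have xee x : x * e = e * x * e.
  have /ann_e : ann ((1 - e) * x) by exact: annMr.
  by rewrite mulrBl mul1r mulrBl => /eqP; rewrite subr_eq0 => /eqP.
exists e; split.
- by move=> x; rewrite xee -exe.
- by have := exe 1; rewrite mulr1 => <-.
- move=> e0; have [l Ll l0] := minimal_left_ideal_neq0 minL.
  by apply: l0; have := annC l Ll; rewrite e0 subr0 mul1r.
- move=> I a [lI IR] Ia ea0; have [I0 ID IM] := lI.
  have [l [Ll al]] : exists l, L l /\ a * l <> 0.
    apply: contrapT => noL; apply: ea0; apply: e_ann => l Ll.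
    by apply: contrapT => al; apply: noL; exists l.
  have IL : I `&` L = L.
    apply: (minimal_left_ideal_eq (x := a * l) minL) => //.
    + have [L0 LD _] := lL; split => // [x y [Ix Lx] [Iy Ly]|x y [Iy Ly]].
        by split; [exact: ID|exact: LD].
      by split; [exact: IM|exact: LM].
    + by split; [exact: IR|exact: LM].
  apply: left_ideal_sum => // k /uK [l' [y [Ll' ->]]]; apply: IR.
  by move: Ll'; rewrite -IL => -[].
- move=> x ex0; have -> : x = (1 - e) * x by rewrite mulrBl ex0 subr0 mul1r.
  exact: annMr.
Qed.

End Blocks.

(** * The corner ring of a central idempotent *)

Section Corner.
Variables (Q : nzRingType) (e : Q).
Hypothesis eC : forall x, e * x = x * e.
Hypothesis ee : e * e = e.
Hypothesis e_neq0 : e <> 0.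

Definition corner_pred : {pred Q} := fun x => e * x == x.

(** The proofs are arguments of the type because its ring structure, with unit
    [e], depends on them. *)
Definition corner of (forall x, e * x = x * e) & e * e = e & e <> 0 : Type :=
  {x : Q | x \in corner_pred}.
Local Notation C := (corner eC ee e_neq0).

Let corner_pred_zmod : zmod_closed corner_pred.
Proof.
split; first by rewrite unfold_in mulr0.
by move=> x y /eqP ex /eqP ey; rewrite unfold_in mulrBr ex ey.
Qed.
HB.instance Definition _ := GRing.isZmodClosed.Build Q corner_pred corner_pred_zmod.
HB.instance Definition _ := SubChoice.on C.
HB.instance Definition _ := [SubChoice_isSubZmodule of C by <:].
Implicit Types x y z : C.

Lemma cornerP x : e * val x = val x.
Proof. exact/eqP/(valP x). Qed.

Let mem_mul x y : val x * val y \in corner_pred.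
Proof. by rewrite unfold_in mulrA cornerP. Qed.
Let mem_one : e \in corner_pred.
Proof. by rewrite unfold_in ee. Qed.

Let one : C := Sub e mem_one.
Let mul x y : C := Sub (val x * val y) (mem_mul x y).

Let mulA : associative mul.
Proof. by move=> x y z; apply: val_inj; rewrite /= mulrA. Qed.
Let mul_onel : left_id one mul.
Proof. by move=> x; apply: val_inj; exact: cornerP. Qed.
Let mul_oner : right_id one mul.
Proof. by move=> x; apply: val_inj; rewrite /= -eC cornerP. Qed.
Let mulDl : left_distributive mul +%R.
Proof. by move=> x y z; apply: val_inj; rewrite /= mulrDl. Qed.
Let mulDr : right_distributive mul +%R.
Proof. by move=> x y z; apply: val_inj; rewrite /= mulrDr. Qed.
Let one_neq0 : one != 0.
Proof. by apply/eqP => /(congr1 val). Qed.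
HB.instance Definition _ :=
  GRing.Zmodule_isNzRing.Build C mulA mul_onel mul_oner mulDl mulDr one_neq0.

Lemma corner_valM x y : val (x * y) = val x * val y. Proof. by []. Qed.

Let corner_proj_mem (x : Q) : e * x \in corner_pred.
Proof. by rewrite unfold_in mulrA ee. Qed.
Definition corner_proj (x : Q) : C := Sub (e * x) (corner_proj_mem x).

Lemma corner_projE (a : Q) : val (corner_proj a) = e * a. Proof. by []. Qed.

Lemma corner_proj_val x : corner_proj (val x) = x.
Proof. by apply: val_inj; exact: cornerP. Qed.

Let corner_projB : {morph corner_proj : x y / x - y}.
Proof. by move=> x y; apply: val_inj; rewrite /= mulrBr. Qed.
Let corner_projM : monoid_morphism corner_proj.
Proof.
split; first by apply: val_inj; rewrite /= mulr1.
move=> x y; apply: val_inj.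
rewrite corner_valM !corner_projE.
by rewrite -(mulrA e x) (mulrA x e) -eC -(mulrA e x) (mulrA e e) ee.
Qed.
HB.instance Definition _ :=
  GRing.isZmodMorphism.Build Q C corner_proj corner_projB.
HB.instance Definition _ :=
  GRing.isMonoidMorphism.Build Q C corner_proj corner_projM.

Lemma corner_left_ideal (I : set C) :
  left_ideal I -> left_ideal (val @` I).
Proof.
move=> [I0 ID IM]; split; first by exists 0.
  by move=> _ _ [x Ix <-] [y Iy <-]; exists (x + y) => //; exact: ID.
move=> a _ [x Ix <-]; exists (corner_proj a * x); first exact: IM.
by rewrite corner_valM corner_projE eC -mulrA cornerP.
Qed.

(** Left ideals of the corner ring are left ideals of [Q]. *)
Lemma corner_left_artinian : left_artinian Q -> left_artinian C.
Proof.
move=> artQ I lI decI.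
have [k|k _ [x Ix <-]|N Nst] := artQ (fun k => val @` I k).
- exact: corner_left_ideal.
- by exists x => //; exact: decI.
exists N => k Nk; apply/seteqP; split => x Ix.
- have : (val @` I k) (val x) by exists x.
  by rewrite Nst // => -[y Iy /val_inj <-].
- have : (val @` I N) (val x) by exists x.
  by rewrite -(Nst k) // => -[y Iy /val_inj <-].
Qed.

Lemma corner_simple :
  (forall (I : set Q) a, two_sided_ideal I -> I a -> e * a <> 0 -> I e) ->
  simple_ring C.
Proof.
move=> simple_e I [lI IR]; have [I0 _ IM] := lI.
have [allI0|/existsNP [x /not_implyP [Ix x0]]] :=
  pselect (forall x, I x -> x = 0).
  by left; apply/seteqP; split => [x /allI0//|x ->].
right; have [|||y Iy ye] := simple_e (val @` I) (val x).
- split; first exact: corner_left_ideal.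
  move=> _ a [y Iy <-]; exists (y * corner_proj a); first exact: IR.
  by rewrite corner_valM corner_projE mulrA -eC cornerP.
- by exists x.
- by rewrite cornerP => vx0; apply: x0; exact: val_inj.
have y1 : y = 1 by apply: val_inj; rewrite ye.
by apply/seteqP; split => // z _; rewrite -(mulr1 z) -y1; exact: IM.
Qed.

(** The fractions of [Q] project onto fractions of [e Q]. The kernel of
    [R -> Q -> e Q] is killed by the numerator [a] of [e = (f c)^-1 f a],
    which is among the elements to be inverted because [f a = f c e] maps to
    a unit of [e Q]. *)
Lemma corner_localization (R : nzRingType) (f : {rmorphism R -> Q}) :
  is_left_localization (regular_elements R) f ->
  left_denominator ((corner_proj \o f) @^-1` units C) /\
  is_left_localization ((corner_proj \o f) @^-1` units C) (corner_proj \o f).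
Proof.
move=> loc; have [Cu _ ker] := loc.
have frac := localization_fraction loc.
apply: left_denominator_of_fractions => //.
- by rewrite /preimage /= !rmorph1; exact: units1.
- by rewrite /preimage /= => s t us ut; rewrite !rmorphM; exact: unitsM.
- move=> q; have [c [r [Cc cq]]] := frac (val q); exists c, r; split.
    by apply: (@rmorph_units _ _ corner_proj); exact: Cu.
  by rewrite /= -cq rmorphM; congr (_ * _); rewrite -[LHS]corner_proj_val.
- move=> r /(congr1 val); rewrite /= => er0.
  have [c [a [Cc ce]]] := frac e; exists a; split.
    rewrite /preimage /= -ce; have -> : corner_proj (f c * e) = corner_proj (f c).
      by apply: val_inj; rewrite !corner_projE -eC mulrA ee.
    by apply: (@rmorph_units _ _ corner_proj); exact: Cu.
  have /ker [s [[ls _] sar]] : f (a * r) = 0.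
    by rewrite rmorphM -ce -mulrA er0 mulr0.
  by apply: ls; rewrite mulr0.
Qed.

End Corner.

(** Write [1 = \sum_k u k] with [u k] in a minimal left ideal [L k]. Each [L k]
    yields a central idempotent [e k], and an element killed by all the
    [e k] annihilates every [u k]. *)
Lemma quotient_ring_embedding (R : nzRingType) :
  has_semisimple_left_quotient_ring R ->
  exists (n : nat) (S : 'I_n -> set R) (Q : 'I_n -> nzRingType)
         (sigma : forall i : 'I_n, {rmorphism R -> Q i}),
    simple_artinian_embedding S sigma.
Proof.
move=> [_ [Q [f [loc [ssQ artQ]]]]].
have [m [L [u [Lu one_sum]]]] := ssQ 1.
have minL k : minimal_left_ideal (L k) by have [] := Lu k.
have Luk k : L k (u k) by have [] := Lu k.
have /choice [e eP] := fun k =>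
  minimal_left_ideal_block minL Luk one_sum (minL k).
have eC k x : e k * x = x * e k by have [] := eP k.
have ee k : e k * e k = e k by have [] := eP k.
have e0 k : e k <> 0 by have [] := eP k.
exists m, (fun k => (corner_proj (eC k) (ee k) (e0 k) \o f) @^-1` units _),
  (fun k => corner (eC k) (ee k) (e0 k)),
  (fun k => corner_proj (eC k) (ee k) (e0 k) \o f).
split => [k|r s rs].
  have [denk lock] := corner_localization (eC k) (ee k) (e0 k) loc.
  split => //; split; last exact: corner_left_artinian.
  by apply: corner_simple; have [] := eP k.
have frs : f (r - s) = 0.
  rewrite -(mulr1 (f _)) one_sum mulr_sumr big1 // => k _.
  have [_ _ _ _ ann_e] := eP k; apply: ann_e => //.
  have /(congr1 val) := congr1 (fun g => g k) rs.
  by rewrite rmorphB mulrBr /= => ->; rewrite subrr.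
have [_ _ ker] := loc; have /ker [c [[lc _] crs]] := frs.
by apply/eqP; rewrite -subr_eq0; apply/eqP/lc; rewrite mulr0.
Qed.

Theorem theorem6p2 (R : nzRingType) :
  (has_semisimple_left_quotient_ring R <->
   exists (n : nat) (S : 'I_n -> set R) (Q : 'I_n -> nzRingType)
          (sigma : forall i : 'I_n, {rmorphism R -> Q i}),
     simple_artinian_embedding S sigma) /\
  (forall (n : nat) (S : 'I_n -> set R) (Q : 'I_n -> nzRingType)
          (sigma : forall i : 'I_n, {rmorphism R -> Q i}),
     simple_artinian_embedding S sigma ->
     max_Den_l R = [set sigma i @^-1` units (Q i) | i in [set: 'I_n]]).
Proof.
split; last exact: max_Den_simple_artinian_embedding.
split; first exact: quotient_ring_embedding.
by move=> [n [S [Q [sigma emb]]]]; exact: embedding_quotient_ring emb.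
Qed.
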